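(* Let $p\geq 5$ be a fixed prime, $\ell\geq 1$ an integer, and $P\in\mathbb{F}_p[t]$ a fixed irreducible monic polynomial. Let $c\in\mathbb{F}_p[t]$ with $c\equiv -1\pmod{P}$, let $g_{c(t)}(x)=x^{(p-1)^\ell}-x+c\in\mathbb{F}_p(t)[x]$ be irreducible, and let $H_{g_{c(t)}}=\mathbb{F}_p(t)[x]/(g_{c(t)}(x))$, of degree $r:=[H_{g_{c(t)}}:\mathbb{F}_p(t)]=(p-1)^\ell$. Let $M(r)$ be the number of intermediate fields $\tilde{L}$ with $\mathbb{F}_p(t)\subset\tilde{L}\subset H_{g_{c(t)}}$. Then $M(r)\leq r\,2^{r!}$, where $r!\sim\frac{r^r}{e^r}\sqrt{2\pi r}$ as $r\to\infty$.
   Context: $\mathbb{F}_p(t)$ is the rational function field over the finite field $\mathbb{F}_p$. In the asymptotic formula $\pi$ is the usual real constant. *)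

(* Defs.v *)
From HB Require Import structures.
From mathcomp Require Import all_boot all_order all_algebra all_field.
From mathcomp Require Import finmap.
From mathcomp Require Import all_classical all_reals.

Set Implicit Arguments.
Unset Strict Implicit.
Unset Printing Implicit Defensive.

Import Order.TTheory GRing.Theory Num.Theory.

Local Open Scope ring_scope.

Definition ratfun (p : nat) : fieldType := {fraction {poly 'F_p}}.

Definition gpoly (p l : nat) (c : {poly 'F_p}) : {poly ratfun p} :=
  'X^(p.-1 ^ l)%N - 'X + (tofrac c : ratfun p)%:P.

Lemma gpoly_monic (p l : nat) (c : {poly 'F_p}) :
  (5 <= p)%N -> (1 <= l)%N -> gpoly l c \is monic.
Proof.
move=> p5 l1.
have r2 : (1 < p.-1 ^ l)%N.
  by rewrite -[1%N](exp1n l) ltn_exp2r //; case: p p5 {c} => [|[|[|]]].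
rewrite /gpoly -addrA monicE lead_coefDl ?lead_coefXn // size_polyXn.
apply: leq_ltn_trans (size_polyD _ _) _.
rewrite gtn_max size_polyN size_polyX ltnS r2 /=.
by apply: leq_ltn_trans (size_polyC_leq1 _) _; rewrite ltnS (ltn_trans _ r2).
Qed.

Definition quotient_field (K : fieldType) (g : {poly K})
    (gmonic : g \is monic) (girr : irreducible_poly g) : fieldExtType K :=
  {poly %/ g with (girr, gmonic)}.

(* A {subfield L} is a K-subalgebra of L, hence contains K, and, L being
   finite-dimensional over K, it is closed under inverses: these are exactly
   the fields between K and L.  Since fset_set A is empty when A is infinite,
   this number is only meaningful together with
   finite_set [set: {subfield L}]. *)
Definition num_intermediate_fields (K : fieldType) (L : fieldExtType K) : nat :=
  #|` fset_set [set: {subfield L}]%classic|%fset.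

(* Main.v *)
Require Import Defs.
From mathcomp Require Import all_boot all_order all_algebra all_field.
From mathcomp Require Import finmap.
From mathcomp Require Import all_classical all_reals all_analysis.
From mathcomp Require Import ring lra zify.
Import Order.TTheory GRing.Theory Num.Theory.
Import numFieldNormedType.Exports.
Local Open Scope classical_set_scope.
Local Open Scope ring_scope.

(** Intermediate fields.  Let x be the class of the variable in H, so that H is
    generated by x over the ground field and x has a minimal polynomial m of
    degree r.  An intermediate field K is determined by the minimal polynomial
    of x over K ([minPoly_subfield_inj]): if K and E give the same polynomial,
    its coefficients lie in the intersection M of K and E, so x has the same
    degree over M as over K, and M = K by comparing dimensions.  Each of these
    polynomials is a monic divisor of m over H, and a polynomial of degree r
    has at most 2 ^ r monic divisors ([monic_divisors_enum]).  Hence there are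
    at most 2 ^ r intermediate fields, and r <= r! gives the stated bound.

    Stirling's formula.  Put d_n = ln n! - (n + 1/2) ln n + n.  Two
    elementary bounds on the logarithm at 1 + 1/n show that d_n - d_(n+1) lies
    between 0 and (1/n - 1/(n+1)) / 4 ([stirling_log_step]), so d has a
    limit L.  In 2 d_n - d_2n, whose limit is L too, only the central binomial
    coefficient, a power of 2 and a square root of n survive
    ([stirling_log_double]), and their asymptotics, i.e. Wallis's product,
    identify
    exp L = sqrt (2 pi) ([stirling_log_lim]).  Wallis's product comes from the
    integrals W_n of cos^n on [0, pi/2]: their recurrence makes
    (n+1) W_(n+1) W_n constant, equal to pi/2, while W_n is nonincreasing, which
    pins n W_n^2 between pi/2 * n/(n+1) and pi/2. *)

(** * Monic divisors of a polynomial *)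

Lemma irreducible_divisor (F : fieldType) (q : {poly F}) :
  (1 < size q)%N -> exists2 f : {poly F}, irreducible_poly f & f %| q.
Proof.
have [n] := ubnP (size q); elim: n q => // n IHn q /ltnSE-qn q1.
have [qirr | qred] := pselect (irreducible_poly q); first by exists q.
have [d [d1 dq dNq]] :
    exists d : {poly F}, [/\ size d != 1%N, d %| q & ~~ (d %= q)].
  apply: contrapT => nod; apply: qred; split => // d d1 dq.
  by apply: contrapT => dNq; apply: nod; exists d; split => //; apply/negP.
have q0 : q != 0 by rewrite -size_poly_gt0 ltnW.
have dltq : (size d < size q)%N.
  by rewrite ltn_neqAle (dvdp_leq q0 dq) (dvdp_size_eqp dq) dNq.
have d0 : d != 0 by apply: dvdpN0 dq q0.
have [|| f firr fd] := IHn d.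
- exact: leq_trans dltq qn.
- by rewrite ltn_neqAle eq_sym d1 size_poly_gt0.
by exists f => //; apply: dvdp_trans fd dq.
Qed.

(** Splitting off an irreducible factor f, say q = q' * f, each monic divisor
    of q either divides q' (when coprime to f) or is a divisor of q' times the
    monic associate of f: adding one factor at most doubles the number of monic
    divisors while the degree grows by at least one. *)
Lemma monic_divisors_enum (F : fieldType) (q : {poly F}) : q != 0 ->
  exists2 s : seq {poly F}, (size s <= 2 ^ (size q).-1)%N &
    forall d, d \is monic -> d %| q -> d \in s.
Proof.
have [n] := ubnP (size q); elim: n q => // n IHn q /ltnSE-qn q0.
have [q1|q_le1] := ltnP 1 (size q); last first.
  exists [:: 1]; first by rewrite expn_gt0.
  move=> d dmon dq; rewrite inE -(eqp_monic dmon (monic1 _)) -size_poly_eq1.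
  rewrite eqn_leq (leq_trans (dvdp_leq q0 dq) q_le1) size_poly_gt0.
  exact: monic_neq0.
have [f firr fq] := irreducible_divisor F q q1.
have [q' qE] : exists q', q = q' * f by exists (q %/ f); rewrite divpK.
have f1 : (1 < size f)%N := firr.1.
have q'0 : q' != 0 by apply: contra_neq q0 => q'0; rewrite qE q'0 mul0r.
have f0 : f != 0 by apply: contra_neq q0 => f0; rewrite qE f0 mulr0.
have szq : ((size q').-1 + (size f).-1 = (size q).-1)%N.
  rewrite qE size_mul//.
  by move: q'0 f1; rewrite -size_poly_gt0; move: (size q') (size f) => a b; lia.
have [|s ss sP] := IHn q' _ q'0.
  apply: leq_trans qn; move: szq q1 f1 q'0; rewrite -size_poly_gt0.
  by move: (size q') (size f) (size q) => a b c; lia.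
pose g := (lead_coef f)^-1 *: f.
have gf : g %= f by rewrite eqp_scale// invr_eq0 lead_coef_eq0.
have gmon : g \is monic by rewrite monicE lead_coefZ mulVf// lead_coef_eq0.
exists (s ++ map ( *%R g) s).
  rewrite size_cat size_map addnn -mul2n.
  have: (2 * 2 ^ (size q').-1 <= 2 ^ (size q).-1)%N.
    rewrite -expnS leq_exp2l//; move: szq f1.
    by move: (size q') (size f) (size q) => a b c; lia.
  by apply: leq_trans; rewrite leq_mul2l ss.
move=> d dmon dq; rewrite mem_cat; have [fd|fNd] := boolP (f %| d).
  apply/orP; right; apply/mapP; exists (d %/ g); last first.
    by rewrite mulrC divpK// (eqp_dvdl _ gf).
  have dE : d = d %/ g * g by rewrite divpK// (eqp_dvdl _ gf).
  apply: sP.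
    by move: dmon; rewrite {1}dE monicMr.
  by move: dq; rewrite {1}dE qE (eqp_dvdl _ (eqp_mull _ gf)) dvdp_mul2r.
rewrite sP// -(@Gauss_dvdpl _ q' f d) -?qE//.
by rewrite coprimep_sym irreducible_poly_coprime.
Qed.

(** * Intermediate fields of a simple extension *)

(** If K and E give x the same minimal polynomial, then its coefficients lie in
    K :&: E, so it is also the minimal polynomial over K :&: E; as x generates
    L, the degree of L over K :&: E equals that over K, hence K :&: E = K. *)
Lemma minPoly_subfield_inj (F : fieldType) (L : fieldExtType F) (x : L) :
  <<1; x>>%VS = fullv ->
  injective (fun K : {subfield L} => minPoly K x).
Proof.
move=> gen_x.
have genK (K : {subfield L}) : <<K; x>>%VS = fullv.
  apply/eqP; rewrite eqEsubv subvf -gen_x; apply/FadjoinP; split.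
    exact: subv_trans (sub1v K) (subv_adjoin K x).
  exact: memv_adjoin.
have cap (K E : {subfield L}) : minPoly K x = minPoly E x -> (K <= E)%VS.
  move=> eqm; set M := [aspace of (K :&: E)%VS].
  have Mm : minPoly K x \is a polyOver M.
    apply/polyOverP => i; rewrite memv_cap (polyOverP (minPolyOver K x)).
    by rewrite eqm (polyOverP (minPolyOver E x)).
  have deg : adjoin_degree M x = adjoin_degree K x.
    apply/eqP; rewrite -eqSS -!size_minPoly eqn_leq.
    rewrite !dvdp_leq ?monic_neq0 ?monic_minPoly//.
      by apply: minPolyS; apply: capvSl.
    by apply: minPoly_dvdp => //; apply: root_minPoly.
  have dimMK : \dim M = \dim K.
    have := dim_Fadjoin M x; rewrite deg genK -(genK K) dim_Fadjoin.
    by move/eqP; rewrite eqn_pmul2l// => /eqP.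
  have /eqP<- : (K :&: E)%VS == K by rewrite eqEdim capvSl /= -dimMK.
  exact: capvSr.
move=> K E eqm; apply/val_inj/eqP.
by rewrite eqEsubv !cap.
Qed.

Lemma intermediate_fields_bound (F : fieldType) (L : fieldExtType F) (x : L) :
  <<1; x>>%VS = fullv ->
  finite_set [set: {subfield L}] /\
  (num_intermediate_fields L <= 2 ^ \dim {: L})%N.
Proof.
move=> gen_x.
have m0 : minPoly 1 x != 0 by rewrite monic_neq0 ?monic_minPoly.
have [s ss sP] := monic_divisors_enum _ _ m0.
have szm : (size (minPoly 1 x)).-1 = \dim {: L}.
  by rewrite size_minPoly /= -gen_x dim_Fadjoin dimv1 muln1.
rewrite szm in ss.
have mem_s (K : {subfield L}) : minPoly K x \in s.
  by apply: sP; [apply: monic_minPoly | apply: minPolyS; apply: sub1v].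
have inj := minPoly_subfield_inj _ _ x gen_x.
have fin : finite_set [set: {subfield L}].
  have -> : [set: {subfield L}] = (fun K => minPoly K x) @^-1` [set` s].
    by apply/seteqP; split => // K _; apply: mem_s.
  apply: (@finite_preimage _ _ [set` s] (fun K : {subfield L} => minPoly K x)).
    by move=> K E _ _; apply: inj.
  exact: finite_seq.
split => //; rewrite /num_intermediate_fields (leq_trans _ ss)//.
rewrite -(size_map (fun K : {subfield L} => minPoly K x)) uniq_leq_size//.
  by rewrite map_inj_uniq// fset_uniq.
by move=> _ /mapP[K _ ->].
Qed.

(** The class of the variable is a generator: a reduced polynomial evaluates
    at it to its own class. *)
Lemma quotient_field_generator (F : fieldType) (g : {poly F})
    (gmonic : g \is monic) (girr : irreducible_poly g) :
  exists x : quotient_field gmonic girr, <<1; x>>%VS = fullv.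
Proof.
exists (in_qpoly g 'X); apply/eqP; rewrite eqEsubv subvf; apply/subvP => v _.
apply/Fadjoin1_polyP; exists (val v).
have -> : map_poly (in_alg (quotient_field gmonic girr)) (val v) =
    map_poly (qpolyC g) (val v).
  apply: eq_map_poly => k; apply: val_inj; rewrite /= /GRing.scale /=.
  exact: alg_polyC.
rewrite -[RHS]in_qpoly_comp_horner comp_polyXr.
by apply: val_inj; rewrite [RHS]in_qpoly_small// size_mk_monic.
Qed.

Lemma dim_quotient_field (F : fieldType) (g : {poly F})
    (gmonic : g \is monic) (girr : irreducible_poly g) :
  \dim {: quotient_field gmonic girr} = (size g).-1.
Proof.
rewrite -[in RHS](mk_monicE (girr, gmonic)).
exact: dim_polyn.
Qed.

Lemma size_gpoly (p l : nat) (c : {poly 'F_p}) :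
  (5 <= p)%N -> (1 <= l)%N -> size (gpoly l c) = (p.-1 ^ l).+1.
Proof.
move=> p5 l1.
have r2 : (1 < p.-1 ^ l)%N.
  by rewrite -[1%N](exp1n l) ltn_exp2r //; case: p p5 {c} => [|[|[|]]].
rewrite /gpoly -addrA size_polyDl size_polyXn//.
apply: leq_ltn_trans (size_polyD _ _) _.
rewrite gtn_max size_polyN size_polyX ltnS r2 /=.
by apply: leq_ltn_trans (size_polyC_leq1 _) _; rewrite ltnS (ltn_trans _ r2).
Qed.

(** * Wallis's product *)

(** The fundamental theorem of calculus for an everywhere differentiable
    primitive, free of one-sided conditions at the end points. *)
Lemma Rintegral_is_derive (R : realType) (F f : R -> R) (a b : R) : a < b ->
  continuous f -> (forall x : R, is_derive x (1 : R) F (f x)) ->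
  \int[lebesgue_measure]_(x in `[a, b]) f x = F b - F a.
Proof.
move=> ab cf dF.
have dF' x : derivable F x 1 by have [] := dF x.
have cF : continuous F.
  by move=> x; apply/differentiable_continuous/derivable1_diffP.
rewrite /Rintegral (@continuous_FTC2 _ f F)//.
- exact: continuous_subspaceT.
- split; first by move=> x _.
    exact: cvg_at_right_filter (cF a).
  exact: cvg_at_left_filter (cF b).
- by move=> x _; rewrite derive1E; have [] := dF x.
Qed.

Definition wallis (R : realType) (n : nat) : R :=
  \int[lebesgue_measure]_(x in `[0, pi / 2]) cos x ^+ n.

Lemma continuous_cosX (R : realType) (n : nat) :
  continuous (fun x : R => cos x ^+ n).
Proof.
move=> x; apply: (@continuous_comp _ _ _ cos (fun y : R => y ^+ n)).
  exact: continuous_cos.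
exact: exprn_continuous.
Qed.

Lemma continuous_segment_integrable (R : realType) (a b : R) (f : R -> R) :
  continuous f -> lebesgue_measure.-integrable `[a, b] (EFin \o f).
Proof.
move=> cf; apply: continuous_compact_integrable; first exact: segment_compact.
exact: continuous_subspaceT.
Qed.

Lemma pihalf_gt0 (R : realType) : 0 < pi / 2 :> R.
Proof. by rewrite divr_gt0 ?pi_gt0. Qed.

Lemma wallis0 (R : realType) : wallis R 0 = pi / 2.
Proof.
rewrite /wallis Rintegral_cst//=.
by rewrite lebesgue_measure_itv/= lte_fin pihalf_gt0 /= mul1r subr0.
Qed.

Lemma wallis1 (R : realType) : wallis R 1 = 1.
Proof.
rewrite /wallis (@Rintegral_is_derive _ sin (fun x => cos x ^+ 1)) //.
- by rewrite sin_pihalf sin0 subr0.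
- exact: pihalf_gt0.
- by move=> x; apply: continuous_cos.
Qed.

(** The difference of the two integrands is the derivative of
    sin * cos ^+ n.+1, which vanishes at both ends of the interval. *)
Lemma wallisSS (R : realType) (n : nat) :
  n.+2%:R * wallis R n.+2 = n.+1%:R * wallis R n.
Proof.
apply/eqP; rewrite -subr_eq0; apply/eqP.
pose f (x : R) := n.+2%:R * cos x ^+ n.+2 - n.+1%:R * cos x ^+ n.
have cM (c : R) m : continuous (fun x : R => c * cos x ^+ m).
  by move=> x; apply: cvgMl_tmp; apply: continuous_cosX.
have intX m :=
  continuous_segment_integrable _ 0 (pi / 2) _ (continuous_cosX R m).
rewrite /wallis -!RintegralZl//.
rewrite -RintegralB//; try exact: continuous_segment_integrable.
have dF (x : R) : is_derive x (1 : R) (fun y => sin y * cos y ^+ n.+1) (f x).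
  have := is_deriveM (is_derive_sin x) (is_deriveX n.+1 (is_derive_cos x)).
  rewrite exprfctE => dF; apply: (is_derive_eq dF).
  rewrite /f /GRing.scale /= !exprS.
  have -> : sin x * (n.+1%:R * cos x ^+ n * - sin x) =
      (cos x ^+ 2 - 1) * (n.+1%:R * cos x ^+ n).
    by rewrite cos2sin2; ring.
  by rewrite [n.+2%:R]mulrS; ring.
rewrite (Rintegral_is_derive _ _ _ _ _ (pihalf_gt0 R) _ dF).
  by rewrite cos_pihalf sin0 mul0r expr0n mulr0 subr0.
by move=> x; apply: cvgB; apply: cM.
Qed.

Lemma wallis_le (R : realType) (n : nat) : wallis R n.+1 <= wallis R n.
Proof.
apply: le_Rintegral => //;
  try exact/continuous_segment_integrable/continuous_cosX.
move=> x /=; rewrite in_itv /= => /andP[x0 x1].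
rewrite exprS ler_piMl ?cos_le1// exprn_ge0// cos_ge0_pihalf// x1.
by rewrite andbT (le_trans _ x0)// oppr_le0 ltW ?pihalf_gt0.
Qed.

(** By [wallisSS] the left-hand side does not change from n to n.+1. *)
Lemma wallis_mulS (R : realType) (n : nat) :
  n.+1%:R * (wallis R n.+1 * wallis R n) = pi / 2.
Proof.
elim: n => [|n IHn]; first by rewrite wallis1 wallis0 !mul1r.
by rewrite mulrA wallisSS -mulrA [wallis R n * _]mulrC.
Qed.

(** The inverse of the central binomial probability 'C(2n, n) / 4 ^ n, i.e. the
    n-th partial product of the (2k)/(2k - 1). *)
Definition central_ratio (R : realType) (n : nat) : R :=
  4 ^+ n * n`!%:R ^+ 2 / (n.*2)`!%:R.

Lemma central_ratio_wallis (R : realType) (n : nat) :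
  central_ratio R n * wallis R n.*2 = pi / 2.
Proof.
elim: n => [|n IHn].
  by rewrite /central_ratio /= fact0 expr1n expr0 wallis0 !mul1r invr1 mul1r.
rewrite -{}IHn /central_ratio doubleS.
have := wallisSS R n.*2; set W := wallis _ _; set W' := wallis _ _ => WS.
have {}WS : W = n.*2.+1%:R * W' / n.*2.+2%:R.
  by rewrite -WS mulrAC mulfV ?mul1r// pnatr_eq0.
rewrite WS !factS !natrM exprS -!muln2 -!natr1 natrM.
have f0 : (n * 2)`!%:R != 0 :> R by rewrite pnatr_eq0 -lt0n fact_gt0.
have n0 : 0 <= n%:R :> R by [].
field; rewrite f0 /=; apply/andP; split; apply: lt0r_neq0; lra.
Qed.

(** The integrals are nonnegative, and none vanishes because the product of two
    consecutive ones is nonzero by [wallis_mulS]. *)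
Lemma wallis_gt0 (R : realType) (n : nat) : 0 < wallis R n.
Proof.
have ge0 m : 0 <= wallis R m.
  apply: Rintegral_ge0 => x /=; rewrite in_itv /= => /andP[x0 x1].
  rewrite exprn_ge0// cos_ge0_pihalf// x1 andbT (le_trans _ x0)// oppr_le0.
  by rewrite ltW ?pihalf_gt0.
rewrite lt_neqAle ge0 andbT eq_sym; apply/eqP => w0.
have := wallis_mulS R n; rewrite w0 !mulr0 => /esym/eqP.
by rewrite gt_eqF ?pihalf_gt0.
Qed.

(** With m = n.+1 and W the integral of cos ^+ m.*2, the monotonicity of the
    integrals squeezes the constant product pi / 2 of consecutive ones:
    2m W^2 <= pi / 2 <= (2m + 1) W^2.  Since central_ratio R m = (pi / 2) / W,
    these are the two bounds. *)
Lemma central_ratio_bounds (R : realType) (n : nat) :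
  pi <= central_ratio R n.+1 ^+ 2 / n.+1%:R <= pi + (pi / 2) * n.+1%:R^-1.
Proof.
set m := n.+1.
have m0 : 0 < m%:R :> R by rewrite ltr0n.
have w0 := wallis_gt0 R m.*2.
have -> : central_ratio R m = pi / 2 / wallis R m.*2.
  by rewrite -(central_ratio_wallis R m) mulfK ?gt_eqF.
set W := wallis R m.*2 in w0 *.
have dm : m.*2%:R = 2 * m%:R :> R by rewrite -mul2n natrM.
have lo : 2 * m%:R * W ^+ 2 <= pi / 2.
  have <- : 2 * m%:R * (W * wallis R n.*2.+1) = pi / 2.
    by rewrite -dm; apply: (wallis_mulS R n.*2.+1).
  by rewrite expr2 ler_pM2l ?mulr_gt0// ler_pM2l//; apply: wallis_le.
have hi : pi / 2 <= (2 * m%:R + 1) * W ^+ 2.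
  have <- : (2 * m%:R + 1) * (wallis R m.*2.+1 * W) = pi / 2.
    by rewrite -dm natr1 wallis_mulS.
  rewrite expr2 ler_pM2l ?ltr_wpDr ?mulr_gt0// ler_pM2r//.
  exact: wallis_le.
have p0 : 0 < pi :> R := pi_gt0 R.
have -> : (pi / 2 / W) ^+ 2 / m%:R = pi * ((pi / 2) / (2 * m%:R * W ^+ 2)) :> R.
  by field; rewrite !gt_eqF.
have -> : pi + pi / 2 / m%:R = pi * ((2 * m%:R + 1) / (2 * m%:R)) :> R.
  by field; rewrite !gt_eqF.
have W20 : 0 < W ^+ 2 by rewrite exprn_gt0.
rewrite ler_peMr ?(ltW p0)//=; last first.
  by rewrite ler_pdivlMr ?mul1r// !mulr_gt0.
rewrite ler_pM2l// ler_pdivrMr ?mulr_gt0//.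
rewrite mulrA divfK; last by rewrite gt_eqF// mulr_gt0.
exact: hi.
Qed.

Lemma central_ratio_cvg (R : realType) :
  (fun n => central_ratio R n ^+ 2 / n%:R) @ \oo --> (pi : R).
Proof.
rewrite -cvg_shiftS /=.
apply: (@squeeze_cvgr _ _ _ _ (fun=> pi) (fun n => pi + (pi / 2) * n.+1%:R^-1)).
- by near=> n; apply: central_ratio_bounds.
- exact: cvg_cst.
- rewrite -[X in _ --> X]addr0 -[X in _ --> _ + X](mulr0 (pi / 2)).
  by apply: cvgD; [exact: cvg_cst | apply: cvgMl_tmp; exact: cvg_harmonic].
Unshelve. all: by end_near. Qed.

(** * Stirling's formula *)

Lemma le_is_derive_ge0 (R : realType) (f df : R -> R) (a : R) :
  (forall x, a <= x -> is_derive x (1 : R) f (df x)) ->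
  (forall x, a <= x -> 0 <= df x) ->
  forall x, a <= x -> f a <= f x.
Proof.
move=> fdf df0 x ax; apply: (@ger0_derive1_ndecry _ f a) => //.
- by move=> y; rewrite in_itv /= andbT => /ltW/fdf[].
- move=> y; rewrite in_itv /= andbT => /ltW ay.
  by rewrite derive1E; have [_ ->] := fdf y ay; apply: df0.
- apply: derivable_within_continuous => y; rewrite in_itv /= andbT.
  by move=> /fdf[].
Qed.

(** Equality holds at 1, and the difference of the two sides has derivative
    (v - 1)^2 / (v (v + 1)^2).  At u = 1 + 1/n the left-hand side is
    1 / (n + 1/2), whose inverse is the weight of ln n in Stirling's formula. *)
Lemma ln_ge_pade (R : realType) (u : R) : 1 <= u ->
  2 * (u - 1) / (u + 1) <= ln u.
Proof.
move=> u1; rewrite -subr_ge0.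
pose f (v : R) := ln v - (2 - 4 * (v + 1)^-1).
have -> : ln u - 2 * (u - 1) / (u + 1) = f u.
  by rewrite /f; field; rewrite gt_eqF//; lra.
have <- : f 1 = 0 by rewrite /f ln1; field.
apply: (@le_is_derive_ge0 _ f (fun v => v^-1 - 4 * (v + 1) ^- 2)) => // v v1.
  have v0 : 0 < v by lra.
  have v10 : v + 1 != 0 by rewrite gt_eqF//; lra.
  have d1 : is_derive v (1 : R) (fun y => y + 1) 1.
    have dD := is_deriveD (is_derive_id v (1 : R)) (is_derive_cst (1 : R) v 1).
    by apply: (is_derive_eq dD); rewrite addr0.
  have dinv := @is_deriveV R (fun y => y + 1) v 1 1 v10 d1.
  have dpade := is_deriveB (is_derive_cst (2 : R) v 1) (is_deriveZ 4 dinv).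
  apply: (is_derive_eq (is_deriveB (is_derive1_ln v0) dpade)).
  by rewrite /GRing.scale /=; ring.
have -> : v^-1 - 4 * (v + 1) ^- 2 = (v - 1) ^+ 2 / (v * (v + 1) ^+ 2).
  by field; rewrite !gt_eqF//; lra.
by rewrite divr_ge0 ?sqr_ge0// mulr_ge0 ?sqr_ge0//; lra.
Qed.

(** This is s <= sinh s for s = ln u; the difference of the two sides has
    derivative (v - 1)^2 / (2 v^2). *)
Lemma ln_le_sinh (R : realType) (u : R) : 1 <= u ->
  ln u <= 2^-1 * (u - u^-1).
Proof.
move=> u1; rewrite -subr_ge0.
pose f (v : R) := 2^-1 * (v - v^-1) - ln v.
have <- : f 1 = 0 by rewrite /f ln1; field.
apply: (@le_is_derive_ge0 _ f (fun v => (1 + v ^- 2) / 2 - v^-1)) => // v v1.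
  have v0 : 0 < v by lra.
  have v0' : v != 0 by rewrite gt_eqF.
  have did := is_derive_id v (1 : R).
  have dinv := @is_deriveV R id v 1 1 v0' did.
  have dsinh := is_deriveZ 2^-1 (is_deriveB did dinv).
  apply: (is_derive_eq (is_deriveB dsinh (is_derive1_ln v0))).
  by rewrite /GRing.scale /=; ring.
have -> : (1 + v ^- 2) / 2 - v^-1 = (v - 1) ^+ 2 / (2 * v ^+ 2).
  by field; rewrite !gt_eqF//; lra.
by rewrite divr_ge0 ?sqr_ge0// mulr_ge0 ?sqr_ge0//; lra.
Qed.

(** The logarithm of n! / (n ^ n e ^ (-n) sqrt n) for n > 0. *)
Definition stirling_log (R : realType) (n : nat) : R :=
  ln n`!%:R - (n%:R + 2^-1) * ln n%:R + n%:R.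

(** With u = 1 + 1/n, the step is (n + 1/2) ln u - 1; the bounds
    [ln_ge_pade] and [ln_le_sinh] evaluate at u to 0 and to a telescoping
    term. *)
Lemma stirling_log_step (R : realType) (n : nat) : (0 < n)%N ->
  0 <= stirling_log R n - stirling_log R n.+1 <= 4^-1 * (n%:R^-1 - n.+1%:R^-1).
Proof.
move=> n_gt0; have n0 : 0 < n%:R :> R by rewrite ltr0n.
have n1 : 0 < n%:R + 1 :> R by lra.
have -> : stirling_log R n - stirling_log R n.+1 =
    (n%:R + 2^-1) * ln ((n%:R + 1) / n%:R) - 1.
  rewrite /stirling_log factS natrM lnM ?posrE ?ltr0n ?fact_gt0//.
  by rewrite ln_div ?posrE// -[n.+1%:R]natr1; field.
set u := (n%:R + 1) / n%:R.
have u1 : 1 <= u by rewrite ler_pdivlMr// mul1r lerDl.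
have h0 : 0 <= n%:R + 2^-1 :> R by lra.
have := ler_wpM2l h0 (ln_ge_pade _ _ u1).
have := ler_wpM2l h0 (ln_le_sinh _ _ u1).
set U := _ * ln u.
have -> : (n%:R + 2^-1) * (2 * (u - 1) / (u + 1)) = 1.
  by rewrite /u; field; rewrite !gt_eqF//; lra.
have -> : (n%:R + 2^-1) * (2^-1 * (u - u^-1)) =
    1 + 4^-1 * (n%:R^-1 - n.+1%:R^-1).
  by rewrite /u -[n.+1%:R]natr1; field; rewrite !gt_eqF//; lra.
by rewrite subr_ge0 lerBlDl => -> ->.
Qed.

(** By [stirling_log_step] the sequence is nonincreasing and becomes
    nondecreasing once 1 / (4n) is subtracted, so it is bounded below. *)
Lemma stirling_log_is_cvg (R : realType) : cvgn (stirling_log R).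
Proof.
suff /cvg_ex[l] : cvgn (fun n => stirling_log R n.+1).
  by rewrite (cvg_shiftS (stirling_log R)) => /cvgP.
apply: nonincreasing_is_cvgn.
  apply/nonincreasing_seqP => n.
  by have /andP[+ _] := stirling_log_step R n.+1 isT; rewrite subr_ge0.
exists (stirling_log R 1 - 4^-1) => _ [n _ <-].
suff: stirling_log R 1 - 4^-1 <= stirling_log R n.+1 - 4^-1 * n.+1%:R^-1.
  by move=> /le_trans; apply; rewrite gerBl mulr_ge0// invr_ge0.
elim: n => [|n /le_trans]; first by rewrite invr1 mulr1.
apply; have /andP[_ h] := stirling_log_step R n.+1 isT.
rewrite -subr_ge0 in h; rewrite -subr_ge0.
by apply: etrans h; congr (_ <= _); ring.
Qed.

(** In this combination the terms n, n ln n and the factorials collapse to the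
    central ratio; squaring removes the square roots of 2 and n. *)
Lemma stirling_log_double (R : realType) (n : nat) : (0 < n)%N ->
  expR (2 * stirling_log R n - stirling_log R n.*2) ^+ 2 =
  2 * (central_ratio R n ^+ 2 / n%:R).
Proof.
move=> n_gt0; have n0 : 0 < n%:R :> R by rewrite ltr0n.
have f0 m : 0 < m`!%:R :> R by rewrite ltr0n fact_gt0.
have -> : 2 * (central_ratio R n ^+ 2 / n%:R) = 
    expR (ln 2 + 2 * (n%:R * ln 4 + 2 * ln n`!%:R - ln (n.*2)`!%:R) - ln n%:R).
  rewrite expRB expRD !lnK ?posrE// mulrA; congr (_ * _ / _).
  by rewrite expRM_natl expRB expRD !expRM_natl !lnK ?posrE.
have l4 : ln 4 = 2 * ln 2 :> R.
  have -> : 4 = 2 ^+ 2 :> R by ring.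
  by rewrite lnXn// mulr_natl.
rewrite -expRM_natl; congr expR.
rewrite /stirling_log -mul2n natrM lnM ?posrE// l4.
by field.
Qed.

(** The combination of [stirling_log_double] tends to 2L - L = L, and the
    Wallis product [central_ratio_cvg] gives exp (2L) = 2 pi. *)
Lemma stirling_log_lim (R : realType) :
  expR (limn (stirling_log R)) = Num.sqrt (2 * pi).
Proof.
have cd := stirling_log_is_cvg R; set L := limn _.
have c2 : (fun n => stirling_log R n.*2) @ \oo --> L.
  apply: (@cvg_comp _ _ _ double (stirling_log R) _ \oo _ _ cd).
  move=> A [N _ NA]; exists N => // n /= Nn; apply: NA => /=.
  by rewrite -addnn (leq_trans Nn)// leq_addr.
pose E n := expR (2 * stirling_log R n - stirling_log R n.*2).
have cE : (fun n => E n ^+ 2) @ \oo --> expR L ^+ 2.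
  suff cE1 : E @ \oo --> expR L.
    by under eq_fun do rewrite expr2; rewrite expr2; apply: cvgM.
  apply: continuous_cvg; first exact: continuous_expR.
  rewrite [X in _ --> X](_ : L = 2 * L - L); last by ring.
  by apply: cvgB => //; apply: cvgMl_tmp.
have cP : (fun n => 2 * (central_ratio R n ^+ 2 / n%:R)) @ \oo --> (2 * pi : R).
  by apply: cvgMl_tmp; apply: central_ratio_cvg.
have cE' : (fun n => E n ^+ 2) @ \oo --> (2 * pi : R).
  apply: cvg_trans cP; apply: near_eq_cvg.
  by near=> n; rewrite /E stirling_log_double//; near: n; apply: nbhs_infty_gt.
have <- : expR L ^+ 2 = 2 * pi by exact: (cvg_unique _ cE cE').
by rewrite sqrtr_sqr ger0_norm// expR_ge0.
Unshelve. all: by end_near. Qed.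

Lemma stirling_ratio (R : realType) (n : nat) : (0 < n)%N ->
  n`!%:R = n%:R ^+ n / expR 1 ^+ n * Num.sqrt (2 * pi * n%:R) *
           expR (stirling_log R n - limn (stirling_log R)).
Proof.
move=> n_gt0; have n0 : 0 < n%:R :> R by rewrite ltr0n.
have f0 : 0 < n`!%:R :> R by rewrite ltr0n fact_gt0.
have -> : Num.sqrt (2 * pi * n%:R) =
    expR (limn (stirling_log R)) * expR (2^-1 * ln n%:R).
  rewrite sqrtrM ?mulr_ge0 ?pi_ge0// stirling_log_lim; congr (_ * _).
  rewrite -[in LHS](lnK (_ : n%:R \is Num.pos))//.
  rewrite [in LHS](_ : ln n%:R = 2%:R * (2^-1 * ln n%:R)); last by field.
  by rewrite expRM_natl sqrtr_sqr ger0_norm ?expR_ge0.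
have -> : n%:R ^+ n = expR (n%:R * ln n%:R) :> R by rewrite expRM_natl lnK.
rewrite -expRM_natl -expRB -!expRD -[LHS](lnK (_ : n`!%:R \is Num.pos))//.
by congr expR; rewrite /stirling_log; field.
Qed.

Lemma stirling (R : realType) :
  (fun n : nat => n`!%:R : R) ~_\oo
    (fun n : nat =>
       n%:R ^+ n / expR 1 ^+ n * Num.sqrt (2 * pi * n%:R) : R).
Proof.
set g := fun n : nat => n%:R ^+ n / expR 1 ^+ n * _.
have rho1 : (fun n => expR (stirling_log R n - limn (stirling_log R))) @ \oo
    --> (1 : R).
  rewrite -[X in _ --> X]expR0 -(subrr (limn (stirling_log R))).
  apply: continuous_cvg; first exact: continuous_expR.
  by apply: cvgB; [exact: stirling_log_is_cvg | exact: cvg_cst].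
apply/eqaddoP => e e0; near=> n.
have n_gt0 : (0 < n)%N by near: n; apply: nbhs_infty_gt.
change (`|n`!%:R - g n| <= e * `|g n|).
rewrite [X in `|X - _|]stirling_ratio// -/(g n).
rewrite -[X in `|_ - X|]mulr1 -mulrBr normrM mulrC ler_wpM2r//.
rewrite distrC.
by near: n; apply: cvgr_dist_le.
Unshelve. all: by end_near. Qed.

(** * The corollary *)

Theorem corollary13p2 (R : realType) (p l : nat) (P c : {poly 'F_p})
    (p_prime : prime p) (p_ge5 : (5 <= p)%N) (l_ge1 : (1 <= l)%N)
    (P_irr : irreducible_poly P) (P_monic : P \is monic)
    (c_mod : c %% P = -1 %% P)
    (g_irr : irreducible_poly (gpoly l c)) :
  let H := quotient_field (gpoly_monic c p_ge5 l_ge1) g_irr in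
  let r := \dim {: H} in
  [/\ r = (p.-1 ^ l)%N,
      finite_set [set: {subfield H}],
      (num_intermediate_fields H <= r * 2 ^ r`!)%N &
      (fun n : nat => n`!%:R : R) ~_\oo
        (fun n : nat =>
           n%:R ^+ n / expR 1 ^+ n * Num.sqrt (2 * pi * n%:R) : R)].
Proof.
move=> H r.
have rE : r = (p.-1 ^ l)%N by rewrite /r dim_quotient_field size_gpoly.
have [x gen_x] :=
  quotient_field_generator _ _ (gpoly_monic c p_ge5 l_ge1) g_irr.
have [fin bound] := intermediate_fields_bound _ _ x gen_x.
split => //; last exact: stirling.
have r_gt0 : (0 < r)%N := adim_gt0 _.
have r_le_fact : (r <= r`!)%N.
  by rewrite dvdn_leq ?fact_gt0// dvdn_fact// r_gt0 leqnn.
apply: leq_trans bound _; rewrite (leq_trans _ (leq_pmull _ r_gt0))//.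
by rewrite leq_exp2l.
Qed.
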